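(* There exists a co-immune regressive set which is not introreducible, not c.e., and not retraceable.
   Context: A set is co-immune if its complement contains no infinite c.e. subset. An infinite set $A$ is regressive if $A=\{a_0,a_1,\dots\}$ with distinct $a_i$ and there is a partial computable $\varphi$ with $\varphi(a_{n+1})=a_n$ for all $n\ge0$ and $\varphi(a_0)=a_0$; it is retraceable if this can be done with $a_0<a_1<\cdots$. An infinite set $A$ is introreducible if $A\le_T C$ for every infinite $C\subseteq A$. *)

(* Defs.v *)
From Stdlib Require Cantor.
From mathcomp Require Import all_boot.
From mathcomp Require Import boolp classical_sets functions cardinality.

Set Implicit Arguments.
Unset Strict Implicit.
Unset Printing Implicit Defensive.

Local Open Scope classical_set_scope.

(* Kleene's partial recursive functions relative to an oracle, presented as
   unary functions: several arguments are packed with the Cantor pairing, whose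
   inverse components are the basic functions [Left] and [Right]. *)
Inductive code : Type :=
| Zero
| Succ
| Left
| Right
| Oracle
| Pair of code & code
| Comp of code & code
| Prec of code & code
| Mu of code.

Definition pairn (x y : nat) : nat := Cantor.to_nat (x, y).

(* [eval B c x y]: the program [c] with oracle (the characteristic function of)
   [B] halts on input [x] with output [y]. In [eval_Mu], [k] only witnesses
   that the values of [f] below [n] are defined and nonzero. *)
Inductive eval (B : set nat) : code -> nat -> nat -> Prop :=
| eval_Zero x : eval B Zero x 0
| eval_Succ x : eval B Succ x x.+1
| eval_Left x y : eval B Left (pairn x y) x
| eval_Right x y : eval B Right (pairn x y) y
| eval_Oracle_in x : B x -> eval B Oracle x 1
| eval_Oracle_notin x : ~ B x -> eval B Oracle x 0
| eval_Pair f g x y z :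
    eval B f x y -> eval B g x z -> eval B (Pair f g) x (pairn y z)
| eval_Comp f g x y z :
    eval B g x y -> eval B f y z -> eval B (Comp f g) x z
| eval_Prec0 f g x y :
    eval B f x y -> eval B (Prec f g) (pairn x 0) y
| eval_PrecS f g x n y z :
    eval B (Prec f g) (pairn x n) y ->
    eval B g (pairn x (pairn n y)) z ->
    eval B (Prec f g) (pairn x n.+1) z
| eval_Mu f x n (k : nat -> nat) :
    eval B f (pairn x n) 0 ->
    (forall m, m < n -> eval B f (pairn x m) (k m).+1) ->
    eval B (Mu f) x n.

Fixpoint oracle_free (c : code) : bool :=
  match c with
  | Oracle => false
  | Pair f g | Comp f g | Prec f g => oracle_free f && oracle_free g
  | Mu f => oracle_free f
  | _ => true
  end.

(* The oracle [set0] is never queried by an oracle-free program. *)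
Definition partial_computable (phi : nat -> option nat) : Prop :=
  exists2 c : code, oracle_free c &
    forall x y, phi x = Some y <-> eval set0 c x y.

Definition turing_reducible (A B : set nat) : Prop :=
  exists c : code, forall x,
    (A x -> eval B c x 1) /\ (~ A x -> eval B c x 0).

Definition ce (A : set nat) : Prop :=
  exists2 phi : nat -> option nat, partial_computable phi &
    A = [set x | exists y, phi x = Some y].

Definition co_immune (A : set nat) : Prop :=
  ~ exists W : set nat, [/\ W `<=` ~` A, infinite_set W & ce W].

Definition regresses (phi : nat -> option nat) (a : nat -> nat) : Prop :=
  phi (a 0) = Some (a 0) /\ forall n, phi (a n.+1) = Some (a n).

Definition regressive (A : set nat) : Prop :=
  infinite_set A /\
  exists a : nat -> nat, exists phi : nat -> option nat,
    [/\ A = range a, injective a, partial_computable phi & regresses phi a].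

Definition retraceable (A : set nat) : Prop :=
  infinite_set A /\
  exists a : nat -> nat, exists phi : nat -> option nat,
    [/\ A = range a, forall n, a n < a n.+1, partial_computable phi
      & regresses phi a].

Definition introreducible (A : set nat) : Prop :=
  infinite_set A /\
  forall C : set nat, C `<=` A -> infinite_set C -> turing_reducible A C.

(* Main.v *)
Require Import Defs.
From Stdlib Require Cantor.
From mathcomp Require Import all_boot.
From mathcomp Require Import boolp classical_sets functions cardinality.
From mathcomp Require Import zify.

(** A finite-injury argument enumerates a tree of strings together with a
    sequence of guesses at an infinite path. Requirement [e] waits for a string
    in the [e]-th c.e. set that extends the part of the path settled by the
    requirements of higher priority and that either lies in the tree already or
    adds one new node to it, and then routes the path through this string. The
    limit path is thus generic: it meets each c.e. set of strings, or from some
    point on no string eligible for extending it belongs to that set. The path is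
    regressive because every node of the tree determines its ancestors, and the
    other properties are instances of genericity:
    - co-immunity: the strings whose tip lies in a given infinite c.e. set;
      only finitely many nodes of the tree do not extend a given point of the
      path, so some element of the set is always eligible;
    - not c.e.: the strings having a sibling in the tree that is enumerated by
      the candidate;
    - not retraceable: the strings with tip [x] and another element [y] such
      that [psi y < x < y], where [psi] is the candidate retracing function;
    - not introreducible: the strings with tip [x] whose other elements include
      a finite extension of the current oracle giving output [0] at [x]. If
      the path meets this set, [x] is on the path although the program answers
      [0]; otherwise the program never answers [0] outside the tree. Iterating
      over all programs yields an infinite subset of the path that does not
      compute it. *)

Set Implicit Arguments.
Unset Strict Implicit.
Unset Printing Implicit Defensive.

Local Open Scope classical_set_scope.

Definition pl (n : nat) : nat := (Cantor.of_nat n).1.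
Definition pr (n : nat) : nat := (Cantor.of_nat n).2.

Lemma pl_pairn x y : pl (pairn x y) = x.
Proof. by rewrite /pl /pairn Cantor.cancel_of_to. Qed.

Lemma pr_pairn x y : pr (pairn x y) = y.
Proof. by rewrite /pr /pairn Cantor.cancel_of_to. Qed.

Lemma pairn_plr n : pairn (pl n) (pr n) = n.
Proof. by rewrite /pairn /pl /pr -surjective_pairing Cantor.cancel_to_of. Qed.

Lemma pairn_inj x y x' y' : pairn x y = pairn x' y' -> x = x' /\ y = y'.
Proof.
by move=> e; rewrite -(pl_pairn x y) -{2}(pr_pairn x y) e pl_pairn pr_pairn.
Qed.

Lemma leq_add_pairn x y : x + y <= pairn x y.
Proof. by have := Cantor.to_nat_non_decreasing x y; rewrite /pairn; lia. Qed.

Lemma leq_pairnl x y : x <= pairn x y.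
Proof. exact: leq_trans (leq_addr _ _) (leq_add_pairn x y). Qed.

Lemma leq_pairnr x y : y <= pairn x y.
Proof. exact: leq_trans (leq_addl _ _) (leq_add_pairn x y). Qed.

Opaque pairn pl pr.

Lemma eval_inv B c x y : eval B c x y ->
  match c with
  | Zero => y = 0
  | Succ => y = x.+1
  | Left => y = pl x
  | Right => y = pr x
  | Oracle => B x /\ y = 1 \/ ~ B x /\ y = 0
  | Pair f g => exists u v, [/\ eval B f x u, eval B g x v & y = pairn u v]
  | Comp f g => exists2 z, eval B g x z & eval B f z y
  | Prec f g =>
      match pr x with
      | 0 => eval B f (pl x) y
      | n.+1 => exists2 z, eval B (Prec f g) (pairn (pl x) n) z &
                  eval B g (pairn (pl x) (pairn n z)) y
      end
  | Mu f => eval B f (pairn x y) 0 /\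
      forall m, m < y -> exists k, eval B f (pairn x m) k.+1
  end.
Proof.
case=> {c x y} //.
- by move=> x y; rewrite pl_pairn.
- by move=> x y; rewrite pr_pairn.
- by move=> x Bx; left.
- by move=> x Bx; right.
- by move=> f g x y z hf hg; exists y, z.
- by move=> f g x y z hg hf; exists y.
- by move=> f g x y hf; rewrite pl_pairn pr_pairn.
- by move=> f g x n y z hp hg; rewrite pl_pairn pr_pairn; exists y.
- by move=> f x n k h0 hk; split=> // m mn; exists (k m); apply: hk.
Qed.

Lemma eval_fun B c x y z : eval B c x y -> eval B c x z -> y = z.
Proof.
move=> h; elim: h z => {c x y}.
- by move=> x z /eval_inv ->.
- by move=> x z /eval_inv ->.
- by move=> x y z /eval_inv ->; rewrite pl_pairn.
- by move=> x y z /eval_inv ->; rewrite pr_pairn.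
- by move=> x Bx z /eval_inv [] [].
- by move=> x Bx z /eval_inv [] [].
- by move=> f g x y z _ IHf _ IHg w /eval_inv [u] [v] [/IHf -> /IHg -> ->].
- by move=> f g x y z _ IHg _ IHf w /eval_inv [u] /IHg <- /IHf.
- by move=> f g x y _ IHf z /eval_inv; rewrite pl_pairn pr_pairn => /IHf.
- move=> f g x n y z _ IHp _ IHg w /eval_inv.
  by rewrite pl_pairn pr_pairn => -[v /IHp <- /IHg].
- move=> f x n k _ IH0 _ IHk m /eval_inv [h0 hk].
  case: (ltngtP n m) => // nm; first by have [i /IH0] := hk _ nm.
  by have := IHk _ nm _ h0.
Qed.

(** * Total computable functions on encoded data *)

Definition total_computable (F : nat -> nat) : Prop :=
  exists2 c : code, oracle_free c & forall n, eval set0 c n (F n).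

Lemma tc_ext F G : F =1 G -> total_computable F -> total_computable G.
Proof. by move=> FG [c oc ec]; exists c => // n; rewrite -FG. Qed.

Lemma tc_comp F G :
  total_computable F -> total_computable G -> total_computable (fun n => F (G n)).
Proof.
move=> [c oc ec] [d od ed]; exists (Comp c d) => /=; first by rewrite oc.
by move=> n; apply: eval_Comp (ed n) (ec _).
Qed.

Lemma tc_pair F G :
  total_computable F -> total_computable G ->
  total_computable (fun n => pairn (F n) (G n)).
Proof.
move=> [c oc ec] [d od ed]; exists (Pair c d) => /=; first by rewrite oc.
by move=> n; apply: eval_Pair.
Qed.

Lemma tc_pl : total_computable pl.
Proof. by exists Left => // n; rewrite -{1}(pairn_plr n); constructor. Qed.

Lemma tc_pr : total_computable pr.
Proof. by exists Right => // n; rewrite -{1}(pairn_plr n); constructor. Qed.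

Lemma tc_succ : total_computable succn.
Proof. by exists Succ => // n; constructor. Qed.

Lemma tc_id : total_computable id.
Proof.
apply: (tc_ext (F := fun n => pairn (pl n) (pr n))); first exact: pairn_plr.
exact: tc_pair tc_pl tc_pr.
Qed.

Lemma tc_const k : total_computable (fun=> k).
Proof.
elim: k => [|k IH]; first by exists Zero => // n; constructor.
exact: tc_comp tc_succ IH.
Qed.

Lemma tc_rec F G :
  total_computable F -> total_computable G ->
  total_computable
    (fun m => iteri (pr m) (fun i y => G (pairn (pl m) (pairn i y))) (F (pl m))).
Proof.
move=> [c oc ec] [d od ed]; exists (Prec c d) => /=; first by rewrite oc.
move=> m; rewrite -{1}(pairn_plr m); elim: (pr m) => [|n IH] /=.
  exact: eval_Prec0.
exact: eval_PrecS IH (ed _).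
Qed.

Lemma tc_pred : total_computable predn.
Proof.
have := tc_rec tc_id (tc_comp tc_pl tc_pr).
move=> /tc_comp /(_ (tc_pair (tc_const 0) tc_id)); apply: tc_ext => n.
by rewrite !(pl_pairn, pr_pairn); case: n => //= n; rewrite !(pl_pairn, pr_pairn).
Qed.

Lemma tc_if (P F G : nat -> nat) :
  total_computable P -> total_computable F -> total_computable G ->
  total_computable (fun n => if P n == 0 then F n else G n).
Proof.
move=> cP cF cG.
have := tc_rec cF (tc_comp cG tc_pl).
move=> /tc_comp /(_ (tc_pair tc_id cP)); apply: tc_ext => n.
by rewrite !(pl_pairn, pr_pairn); case: (P n) => //= k; rewrite !(pl_pairn, pr_pairn).
Qed.

Class encodable (T : Type) := Encodable {
  enc : T -> nat;
  enc_inj : injective enc }.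

#[export] Instance encodable_nat : encodable nat := Encodable (@inj_id nat).

Lemma nat_of_bool_inj : injective nat_of_bool.
Proof. by move=> [] []. Qed.

#[export] Instance encodable_bool : encodable bool := Encodable nat_of_bool_inj.

Section ProdSeq.
Context (S T : Type) {eS : encodable S} {eT : encodable T}.

Definition enc_prod (p : S * T) : nat := pairn (enc p.1) (enc p.2).

Lemma enc_prod_inj : injective enc_prod.
Proof.
by move=> [x y] [x' y'] /pairn_inj [/= e1 e2]; rewrite (enc_inj e1) (enc_inj e2).
Qed.

Fixpoint enc_seq (s : seq T) : nat :=
  if s is x :: s' then (pairn (enc x) (enc_seq s')).+1 else 0.

Lemma enc_seq_inj : injective enc_seq.
Proof.
elim=> [|x s IH] [|y t] //= [] /pairn_inj [e1 e2].
by rewrite (enc_inj e1) (IH _ e2).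
Qed.

End ProdSeq.

#[export] Instance encodable_prod S T (eS : encodable S) (eT : encodable T) :
  encodable (S * T) := Encodable (@enc_prod_inj S T eS eT).
#[export] Instance encodable_seq T (eT : encodable T) :
  encodable (seq T) := Encodable (@enc_seq_inj T eT).

Lemma enc_pair S T (eS : encodable S) (eT : encodable T) (x : S) (y : T) :
  enc (x, y) = pairn (enc x) (enc y).
Proof. by []. Qed.

Lemma enc_cons T (eT : encodable T) (x : T) s :
  enc (x :: s) = (pairn (enc x) (enc s)).+1.
Proof. by []. Qed.

Lemma leq_size_enc T (eT : encodable T) (s : seq T) : size s <= enc s.
Proof.
by elim: s => //= x s IH; rewrite ltnS (leq_trans IH) // leq_pairnr.
Qed.

Lemma enc_eq (T : eqType) (eT : encodable T) (x y : T) : (enc x == enc y) = (x == y).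
Proof. by apply/eqP/eqP => [e|->//]; exact: enc_inj e. Qed.

Lemma enc_seq_surj (n : nat) : exists s : seq nat, enc s = n.
Proof.
elim/ltn_ind: n => -[|n] IH; first by exists [::].
have [|s es] := IH (pr n).
  by rewrite ltnS -[leqRHS]pairn_plr leq_pairnr.
by exists (pl n :: s); rewrite enc_cons es pairn_plr.
Qed.

Definition dec (n : nat) : seq nat := projT1 (cid (enc_seq_surj n)).

Lemma decK n : enc (dec n) = n.
Proof. exact: (projT2 (cid (enc_seq_surj n))). Qed.

Lemma encK s : dec (enc s) = s.
Proof. by apply: enc_inj; rewrite decK. Qed.

(* The realizer is total on all of nat, also outside the range of [enc]: thus both
   branches of a conditional may be evaluated. *)
Definition computable S T (eS : encodable S) (eT : encodable T) (f : S -> T) : Prop :=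
  exists2 F, total_computable F & forall x, enc (f x) = F (enc x).
Arguments computable {S T eS eT} f.

Section Closure.
Context (X A B : Type) {eX : encodable X} {eA : encodable A} {eB : encodable B}.

Lemma cmp_ext (f g : X -> A) : f =1 g -> computable f -> computable g.
Proof. by move=> fg [F cF eF]; exists F => // x; rewrite -fg. Qed.

Lemma cmp_id : computable (fun x : X => x).
Proof. by exists id => //; exact: tc_id. Qed.

Lemma cmp_const (a : A) : computable (fun _ : X => a).
Proof. by exists (fun=> enc a) => //; exact: tc_const. Qed.

Lemma cmp_comp (f : A -> B) (g : X -> A) :
  computable f -> computable g -> computable (fun x => f (g x)).
Proof.
move=> [F cF eF] [G cG eG]; exists (fun n => F (G n)); first exact: tc_comp.
by move=> x; rewrite eF eG.
Qed.

Lemma cmp_pair (f : X -> A) (g : X -> B) :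
  computable f -> computable g -> computable (fun x => (f x, g x)).
Proof.
move=> [F cF eF] [G cG eG]; exists (fun n => pairn (F n) (G n)).
  exact: tc_pair.
by move=> x; rewrite -eF -eG.
Qed.

Lemma cmp_fst (f : X -> A * B) : computable f -> computable (fun x => (f x).1).
Proof.
move=> [F cF eF]; exists (fun n => pl (F n)); first exact: tc_comp tc_pl cF.
by move=> x; rewrite -eF pl_pairn.
Qed.

Lemma cmp_snd (f : X -> A * B) : computable f -> computable (fun x => (f x).2).
Proof.
move=> [F cF eF]; exists (fun n => pr (F n)); first exact: tc_comp tc_pr cF.
by move=> x; rewrite -eF pr_pairn.
Qed.

Lemma cmp_if (b : X -> bool) (f g : X -> A) :
  computable b -> computable f -> computable g ->
  computable (fun x => if b x then f x else g x).
Proof.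
move=> [P cP eP] [F cF eF] [G cG eG].
exists (fun n => if P n == 0 then G n else F n); first exact: tc_if.
by move=> x; rewrite -eP -eF -eG; case: (b x).
Qed.

Lemma cmp_enc (f : X -> A) : computable f -> computable (fun x => enc (f x)).
Proof. by move=> [F cF eF]; exists F => // x; rewrite -eF. Qed.

Lemma cmp_dec (f : X -> nat) : computable f -> computable (fun x => dec (f x)).
Proof. by move=> [F cF eF]; exists F => // x; rewrite decK -eF. Qed.

Lemma cmp_pl (f : X -> nat) : computable f -> computable (fun x => pl (f x)).
Proof.
move=> [F cF eF]; exists (fun n => pl (F n)); first exact: tc_comp tc_pl cF.
by move=> x; rewrite -eF.
Qed.

Lemma cmp_pr (f : X -> nat) : computable f -> computable (fun x => pr (f x)).
Proof.
move=> [F cF eF]; exists (fun n => pr (F n)); first exact: tc_comp tc_pr cF.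
by move=> x; rewrite -eF.
Qed.

Lemma cmp_pairn (f g : X -> nat) :
  computable f -> computable g -> computable (fun x => pairn (f x) (g x)).
Proof.
move=> [F cF eF] [G cG eG]; exists (fun n => pairn (F n) (G n)).
  exact: tc_pair.
by move=> x; rewrite -eF -eG.
Qed.

Lemma cmp_succ (f : X -> nat) : computable f -> computable (fun x => (f x).+1).
Proof.
move=> [F cF eF]; exists (fun n => (F n).+1); first exact: tc_comp tc_succ cF.
by move=> x; rewrite -eF.
Qed.

Lemma cmp_pred (f : X -> nat) : computable f -> computable (fun x => (f x).-1).
Proof.
move=> [F cF eF]; exists (fun n => (F n).-1); first exact: tc_comp tc_pred cF.
by move=> x; rewrite -eF.
Qed.

Lemma cmp_nat_of_bool (f : X -> bool) :
  computable f -> computable (fun x => nat_of_bool (f x)).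
Proof. by move=> [F cF eF]; exists F => // x; rewrite -eF. Qed.

Lemma cmp_iteri (n : X -> nat) (a : X -> A) (f : X * (nat * A) -> A) :
  computable n -> computable a -> computable f ->
  computable (fun x => iteri (n x) (fun i y => f (x, (i, y))) (a x)).
Proof.
move=> [N cN eN] [G cG eG] [F cF eF].
eexists; first exact: (tc_comp (tc_rec cG cF) (tc_pair tc_id cN)).
move=> x /=; rewrite pl_pairn pr_pairn -eN /=.
by elim: (n x) => [|k IH] /=; rewrite ?eG // eF !enc_pair IH.
Qed.

Lemma cmp_cons (f : X -> A) (g : X -> seq A) :
  computable f -> computable g -> computable (fun x => f x :: g x).
Proof.
move=> [F cF eF] [G cG eG]; exists (fun n => (pairn (F n) (G n)).+1).
  exact: tc_comp tc_succ (tc_pair cF cG).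
by move=> x; rewrite enc_cons eF eG.
Qed.

Lemma cmp_case (l : X -> seq A) (f : X * (A * seq A) -> B) (g : X -> B) :
  computable l -> computable f -> computable g ->
  computable (fun x => if l x is h :: t then f (x, (h, t)) else g x).
Proof.
move=> [L cL eL] [F cF eF] [G cG eG].
exists (fun n => if L n == 0 then G n else F (pairn n (L n).-1)).
  apply: tc_if => //; apply: (tc_comp cF); apply: tc_pair tc_id _.
  exact: tc_comp tc_pred cL.
by move=> x; rewrite -eL; case: (l x) => [|h t] /=; rewrite -?eG // eF.
Qed.

End Closure.

Section Closure2.
Context (X A B : Type) {eX : encodable X} {eA : encodable A} {eB : encodable B}.

Lemma cmp_andb (f g : X -> bool) :
  computable f -> computable g -> computable (fun x => f x && g x).
Proof. by move=> cf cg; exact: cmp_if cf cg (cmp_const _). Qed.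

Lemma cmp_orb (f g : X -> bool) :
  computable f -> computable g -> computable (fun x => f x || g x).
Proof. by move=> cf cg; exact: cmp_if cf (cmp_const _) cg. Qed.

Lemma cmp_negb (f : X -> bool) : computable f -> computable (fun x => ~~ f x).
Proof. by move=> cf; exact: cmp_if cf (cmp_const _) (cmp_const _). Qed.

Lemma cmp_subn (f g : X -> nat) :
  computable f -> computable g -> computable (fun x => f x - g x).
Proof.
move=> cf cg.
have := cmp_iteri cg cf (cmp_pred (cmp_snd (cmp_snd (cmp_id (X := X * (nat * nat)))))).
apply: cmp_ext => x /=; elim: (g x) => [|n IH] /=; first by rewrite subn0.
by rewrite IH subnS.
Qed.

Lemma cmp_eq0 (f : X -> nat) : computable f -> computable (fun x => f x == 0).
Proof.
move=> [F cF eF]; exists (fun n => if F n == 0 then 1 else 0).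
  by apply: tc_if => //; exact: tc_const.
by move=> x; rewrite -eF /=; case: (_ == _).
Qed.

Lemma cmp_leq (f g : X -> nat) :
  computable f -> computable g -> computable (fun x => f x <= g x).
Proof. by move=> cf cg; exact: cmp_eq0 (cmp_subn cf cg). Qed.

Lemma cmp_eq (T : eqType) (eT : encodable T) (f g : X -> T) :
  computable f -> computable g -> computable (fun x => f x == g x).
Proof.
move=> /cmp_enc cf /cmp_enc cg.
apply: cmp_ext (cmp_andb (cmp_leq cf cg) (cmp_leq cg cf)) => x.
by rewrite -eqn_leq enc_eq.
Qed.

Lemma cmp_head (a : A) (f : X -> seq A) :
  computable f -> computable (fun x => head a (f x)).
Proof.
move=> cf.
apply: cmp_ext (cmp_case cf (cmp_fst (cmp_snd (cmp_id (X := X * (A * seq A))))) (cmp_const a)) => x.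
by case: (f x).
Qed.

Lemma cmp_behead (f : X -> seq A) :
  computable f -> computable (fun x => behead (f x)).
Proof.
move=> cf.
apply: cmp_ext (cmp_case cf (cmp_snd (cmp_snd (cmp_id (X := X * (A * seq A))))) (cmp_const [::])) => x.
by case: (f x).
Qed.

End Closure2.

Fixpoint drop_until T (p : seq T -> bool) (s : seq T) : seq T :=
  if p s then s else if s is _ :: s' then drop_until p s' else [::].

Lemma drop_until_iteri T (p : seq T -> bool) n s : size s <= n ->
  drop_until p s = iteri n (fun _ t => if p t then t else behead t) s.
Proof.
set g := fun t => if p t then t else behead t.
have -> : iteri n (fun=> g) s = iter n g s by elim: n => //= n ->.
elim: n s => [|n IH] s sn; first by case: s sn => //= _; case: ifP.
case: s sn => [|x s] /= sn.
  by rewrite -IH //= /g; case: ifP => // _; case: ifP.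
rewrite -iterS iterSr {2}/g; case: ifP => ps; last by rewrite -IH.
by elim: n {IH sn} => //= n <-; rewrite /g ps.
Qed.

Lemma cmp_drop_until X A (eX : encodable X) (eA : encodable A)
    (p : X * seq A -> bool) (l : X -> seq A) :
  computable p -> computable l ->
  computable (fun x => drop_until (fun s => p (x, s)) (l x)).
Proof.
move=> cp cl.
pose q (z : X * (nat * seq A)) := if p (z.1, z.2.2) then z.2.2 else behead z.2.2.
have cq : computable q.
  have c2 : computable (fun z : X * (nat * seq A) => z.2.2).
    by apply: cmp_snd; apply: cmp_snd; exact: cmp_id.
  apply: cmp_if => //; last exact: cmp_behead.
  apply: (cmp_comp cp); apply: cmp_pair => //; apply: cmp_fst; exact: cmp_id.
apply: cmp_ext (cmp_iteri (cmp_enc cl) cl cq) => x.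
by rewrite (@drop_until_iteri _ _ (enc (l x))) // leq_size_enc.
Qed.

Lemma cmp_has X A (eX : encodable X) (eA : encodable A)
    (p : X * A -> bool) (l : X -> seq A) :
  computable p -> computable l ->
  computable (fun x => has (fun a => p (x, a)) (l x)).
Proof.
move=> cp cl.
pose q (z : X * seq A) := if z.2 is h :: t then p (z.1, h) else false.
have cq : computable q.
  apply: (cmp_case (f := fun y => p (y.1.1, y.2.1)) (cmp_snd (cmp_id (X := X * seq A)))).
    apply: (cmp_comp cp); apply: cmp_pair; apply: cmp_fst.
      by apply: cmp_fst; exact: cmp_id.
    by apply: cmp_snd; exact: cmp_id.
  exact: cmp_const.
apply: cmp_ext (cmp_negb (cmp_eq0 (cmp_enc (cmp_drop_until cq cl)))) => x.
by elim: (l x) => //= a s IH; rewrite {1}/q /=; case: ifP.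
Qed.

Lemma cmp_mem X (T : eqType) (eX : encodable X) (eT : encodable T)
    (f : X -> T) (l : X -> seq T) :
  computable f -> computable l -> computable (fun x => f x \in l x).
Proof.
move=> cf cl.
have cp : computable (fun z : X * T => f z.1 == z.2).
  by apply: cmp_eq; [apply: (cmp_comp cf); apply: cmp_fst|apply: cmp_snd]; exact: cmp_id.
apply: cmp_ext (cmp_has cp cl) => x /=.
by rewrite -has_pred1; apply: eq_has => y /=; rewrite eq_sym.
Qed.

Lemma suffix_consr (T : eqType) (s t : seq T) x :
  suffix s (x :: t) = (s == x :: t) || suffix s t.
Proof.
apply/idP/orP => [/suffixP [[|y r] e]|[/eqP ->|]]; last 2 first.
- exact: suffix_refl.
- by move=> /suffix_trans; apply; exact: suffix_cons.
- by left; rewrite e.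
- by right; case: e => _ ->; exact: suffix_suffix.
Qed.

Lemma cmp_suffix X (T : eqType) (eX : encodable X) (eT : encodable T)
    (f g : X -> seq T) :
  computable f -> computable g -> computable (fun x => suffix (f x) (g x)).
Proof.
move=> cf cg.
have cp : computable (fun z : X * seq T => f z.1 == z.2).
  by apply: cmp_eq; [apply: (cmp_comp cf); apply: cmp_fst|apply: cmp_snd]; exact: cmp_id.
apply: cmp_ext (cmp_eq (cmp_drop_until cp cg) cf) => x /=.
elim: (g x) => [|a s IH] /=.
  by rewrite suffixs0 if_same eq_sym.
rewrite suffix_consr; case: ifP => [/eqP e|_]; last by rewrite IH.
by rewrite e eqxx.
Qed.

Ltac cmp :=
  match goal with
  | h : ?P |- ?P => exact h
  | |- computable (fun x => x) => apply: cmp_id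
  | |- computable fst => exact: (cmp_fst (cmp_id (X := _ * _)))
  | |- computable snd => exact: (cmp_snd (cmp_id (X := _ * _)))
  | |- computable (fun x => _.1) => apply: cmp_fst; cmp
  | |- computable (fun x => _.2) => apply: cmp_snd; cmp
  | |- computable (fun x => (_, _)) => apply: cmp_pair; cmp
  | |- computable (fun x => pl _) => apply: cmp_pl; cmp
  | |- computable (fun x => pr _) => apply: cmp_pr; cmp
  | |- computable (fun x => pairn _ _) => apply: cmp_pairn; cmp
  | |- computable (fun x => if _ then _ else _) => apply: cmp_if; cmp
  | |- computable (fun x => _ && _) => apply: cmp_andb; cmp
  | |- computable (fun x => _ || _) => apply: cmp_orb; cmp
  | |- computable (fun x => ~~ _) => apply: cmp_negb; cmp
  | |- computable (fun x => _ == _) => apply: cmp_eq; cmp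
  | |- computable (fun x => _ <= _) => apply: cmp_leq; cmp
  | |- computable (fun x => _ :: _) => apply: cmp_cons; cmp
  | |- computable (fun x => head _ _) => apply: cmp_head; cmp
  | |- computable (fun x => behead _) => apply: cmp_behead; cmp
  | |- computable (fun x => dec _) => apply: cmp_dec; cmp
  | |- computable (fun x => enc _) => apply: cmp_enc; cmp
  | |- computable (fun x => suffix _ _) => apply: cmp_suffix; cmp
  | |- computable (fun x => nat_of_bool _) => apply: cmp_nat_of_bool; cmp
  | |- computable (fun x => _.-1) => apply: cmp_pred; cmp
  | |- computable (fun x => _ \in _) => apply: cmp_mem; cmp
  | |- computable (fun x => ?a) => apply: cmp_const
  | |- computable (fun x => _.+1) => apply: cmp_succ; cmp
  | |- _ => idtac
  end.

(** * A universal machine *)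

Fixpoint gn (c : code) : nat :=
  match c with
  | Zero => pairn 0 0
  | Succ => pairn 1 0
  | Left => pairn 2 0
  | Right => pairn 3 0
  | Oracle => pairn 4 0
  | Pair f g => pairn 5 (pairn (gn f) (gn g))
  | Comp f g => pairn 6 (pairn (gn f) (gn g))
  | Prec f g => pairn 7 (pairn (gn f) (gn g))
  | Mu f => pairn 8 (gn f)
  end.

Lemma gn_inj : injective gn.
Proof.
elim=> [| | | | |f IHf g IHg|f IHf g IHg|f IHf g IHg|f IHf]
  [| | | | |f' g'|f' g'|f' g'|f'] //= /pairn_inj [] //.
- by move=> _ /pairn_inj [/IHf -> /IHg ->].
- by move=> _ /pairn_inj [/IHf -> /IHg ->].
- by move=> _ /pairn_inj [/IHf -> /IHg ->].
- by move=> _ /IHf ->.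
Qed.

(* A state consists of the instructions left and of a stack of values. The
   instruction [gn c] replaces the top value by its image under [c]; tags 9 to
   12 combine the intermediate results of [Pair], [Prec] and [Mu]. *)
Definition state : Type := (seq nat * seq nat)%type.

Definition mstep (o : nat -> bool) (st : state) : state :=
  if st.1 == [::] then st else
  let i := head 0 st.1 in
  let t := pl i in
  let a := pr i in
  let is' := behead st.1 in
  let x := head 0 st.2 in
  let vs := behead st.2 in
  let y := head 0 vs in
  let ws := behead vs in
  if t == 0 then (is', 0 :: vs)
  else if t == 1 then (is', x.+1 :: vs)
  else if t == 2 then (is', pl x :: vs)
  else if t == 3 then (is', pr x :: vs)
  else if t == 4 then (is', nat_of_bool (o x) :: vs)
  else if t == 5 then
    (pl a :: pairn 9 0 :: pr a :: pairn 10 0 :: is', x :: x :: vs)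
  else if t == 6 then (pr a :: pl a :: is', x :: vs)
  else if t == 7 then
    if pr x == 0 then (pl a :: is', pl x :: vs) else
    (i :: pairn 11 0 :: pr a :: is',
      pairn (pl x) (pr x).-1 :: pairn (pl x) (pr x).-1 :: vs)
  else if t == 8 then
    (a :: pairn 12 a :: is', pairn x 0 :: pairn x 0 :: vs)
  else if t == 9 then (is', y :: x :: ws)
  else if t == 10 then (is', pairn y x :: ws)
  else if t == 11 then (is', pairn (pl y) (pairn (pr y) x) :: ws)
  else if x == 0 then (is', pr y :: ws)
  else (a :: i :: is',
         pairn (pl y) (pr y).+1 :: pairn (pl y) (pr y).+1 :: ws).

Definition run (o : nat -> bool) (t : nat) (st : state) : state :=
  iter t (mstep o) st.

Lemma run_add o s t st : run o (s + t) st = run o s (run o t st).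
Proof. exact: iterD. Qed.

Lemma run_nil o t vs : run o t ([::], vs) = ([::], vs).
Proof. by elim: t => //= t ->. Qed.

Lemma runS o t st : run o t.+1 st = run o t (mstep o st).
Proof. exact: iterSr. Qed.

Section MachineCorrect.
Variable o : nat -> bool.
Notation B := [set x | o x].
Let mE := (pl_pairn, pr_pairn).

Let reaches st st' := exists t, run o t st = st'.

Let reaches_trans st1 st2 st3 : reaches st1 st2 -> reaches st2 st3 -> reaches st1 st3.
Proof. by move=> [s e1] [t e2]; exists (t + s); rewrite run_add e1. Qed.

Let reaches_step st st' : reaches (mstep o st) st' -> reaches st st'.
Proof. by move=> [t e]; exists t.+1; rewrite runS. Qed.

Let reaches_refl st : reaches st st.
Proof. by exists 0. Qed.

Lemma eval_reaches c x y is' vs : eval B c x y ->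
  reaches (gn c :: is', x :: vs) (is', y :: vs).
Proof.
move=> h; elim: h is' vs => {c x y}.
- move=> x is' vs; apply: reaches_step; rewrite /mstep /= !mE /=; exact: reaches_refl.
- move=> x is' vs; apply: reaches_step; rewrite /mstep /= !mE /=; exact: reaches_refl.
- move=> x y is' vs; apply: reaches_step; rewrite /mstep /= !mE /=; exact: reaches_refl.
- move=> x y is' vs; apply: reaches_step; rewrite /mstep /= !mE /=; exact: reaches_refl.
- move=> x /= Bx is' vs; apply: reaches_step.
  rewrite /mstep /= !mE /= Bx; exact: reaches_refl.
- move=> x /= /negP /negbTE Bx is' vs; apply: reaches_step.
  rewrite /mstep /= !mE /= Bx; exact: reaches_refl.
- move=> f g x y z _ IHf _ IHg is' vs; apply: reaches_step.
  rewrite /mstep /= !mE /=; apply: reaches_trans (IHf _ _) _.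
  apply: reaches_step; rewrite /mstep /= !mE /=; apply: reaches_trans (IHg _ _) _.
  apply: reaches_step; rewrite /mstep /= !mE /=; exact: reaches_refl.
- move=> f g x y z _ IHg _ IHf is' vs; apply: reaches_step.
  rewrite /mstep /= !mE /=; apply: reaches_trans (IHg _ _) _; exact: IHf.
- move=> f g x y _ IHf is' vs; apply: reaches_step.
  rewrite /mstep /= !mE /=; exact: IHf.
- move=> f g x n y z _ IHp _ IHg is' vs; apply: reaches_step.
  rewrite /mstep /= !mE /=; apply: reaches_trans (IHp _ _) _.
  apply: reaches_step; rewrite /mstep /= !mE /=; exact: IHg.
- move=> f x n k _ IH0 _ IHk is' vs; apply: reaches_step.
  rewrite /mstep /= !mE /=.
  suff loop d m : m + d = n ->
      reaches (gn f :: pairn 12 (gn f) :: is', pairn x m :: pairn x m :: vs)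
              (is', n :: vs) by exact: (loop n 0).
  elim: d m => [|d IH] m mn.
    rewrite addn0 in mn; rewrite mn; apply: reaches_trans (IH0 _ _) _.
    apply: reaches_step; rewrite /mstep /= !mE /=; exact: reaches_refl.
  apply: reaches_trans (IHk m _ _ _) _; first by rewrite -mn -addSnnS leq_addr.
  apply: reaches_step; rewrite /mstep /= !mE /=; apply: IH; lia.
Qed.

Lemma run_eval k c x is' vs r : run o k (gn c :: is', x :: vs) = ([::], r) ->
  exists y k', [/\ k' <= k, eval B c x y & run o k' (is', y :: vs) = ([::], r)].
Proof.
elim/ltn_ind: k c x is' vs => -[|k] IH c x is' vs //.
have stop y : eval B c x y -> run o k (is', y :: vs) = ([::], r) ->
    exists y k', [/\ k' <= k.+1, eval B c x y & run o k' (is', y :: vs) = ([::], r)].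
  by move=> ? ?; exists y, k; split.
rewrite runS; case: c stop => [| | | | |f g|f g|f g|f] stop;
  rewrite /mstep /= !mE /=.
- by apply: stop; constructor.
- by apply: stop; constructor.
- by apply: stop; rewrite -{1}(pairn_plr x); constructor.
- by apply: stop; rewrite -{1}(pairn_plr x); constructor.
- by apply: stop; case: (boolP (o x)) => ox; constructor => //; apply/negP.
- move=> /(IH k (leqnn _)) [y [k1 [k1k ef]]].
  case: k1 k1k => // k1 k1k; rewrite runS /mstep /= !mE /=.
  move=> /(IH k1 (leq_trans k1k (leqnSn _))) [z [k2 [k2k eg]]].
  case: k2 k2k => // k2 k2k; rewrite runS /mstep /= !mE /= => e.
  by exists (pairn y z), k2; split=> //; [lia|exact: eval_Pair].
- move=> /(IH k (leqnn _)) [y [k1 [k1k eg]]].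
  move=> /(IH k1) [|z [k2 [k2k ef e]]]; first lia.
  by exists z, k2; split=> //; [lia|apply: eval_Comp eg ef].
- case en: (pr x) => [|n] /=.
    move=> /(IH k (leqnn _)) [y [k1 [k1k ef e]]].
    exists y, k1; split=> //; first lia.
    by rewrite -(pairn_plr x) en; exact: eval_Prec0.
  move=> /(IH k (leqnn _) (Prec f g)) [y [k1 [k1k ep]]].
  case: k1 k1k => // k1 k1k; rewrite runS /mstep /= !mE /=.
  move=> /(IH k1) [|z [k2 [k2k eg e]]]; first lia.
  exists z, k2; split=> //; first lia.
  by rewrite -(pairn_plr x) en; apply: eval_PrecS ep eg.
- suff loop j m : j <= k -> (forall i, i < m -> exists v, eval B f (pairn x i) v.+1) ->
      run o j (gn f :: pairn 12 (gn f) :: is', pairn x m :: pairn x m :: vs) = ([::], r) ->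
      exists y k', [/\ k' <= k.+1, eval B (Mu f) x y & run o k' (is', y :: vs) = ([::], r)].
    exact: loop.
  elim/ltn_ind: j m => j IHj m jk hm.
  move=> /(IH j jk) [[|v] [k1 [k1k ef]]];
    case: k1 k1k => // k1 k1k; rewrite runS /mstep /= !mE /= => e.
    have [v hv] : {v : nat -> nat & forall i, i < m -> eval B f (pairn x i) (v i).+1}.
      apply: (@choice _ _ (fun i v => i < m -> eval B f (pairn x i) v.+1)) => i.
      by case: (ltnP i m) => im; [have [v] := hm _ im; exists v|exists 0].
    by exists m, k1; split=> //; [lia|apply: eval_Mu ef hv].
  apply: (IHj k1) e => //; first lia.
  move=> i; rewrite ltnS leq_eqVlt => /orP [/eqP ->|/hm //]; by exists v.
Qed.

Lemma evalP c x y :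
  eval B c x y <-> exists t, run o t ([:: gn c], [:: x]) = ([::], [:: y]).
Proof.
split=> [h|[t /run_eval [z [k [_ h]]]]]; first exact: eval_reaches.
by rewrite run_nil => -[<-].
Qed.

Lemma haltsP c x :
  (exists y, eval B c x y) <-> exists t, (run o t ([:: gn c], [:: x])).1 == [::].
Proof.
split=> [[y /evalP [t e]]|[t]]; first by exists t; rewrite e.
case e: (run _ _ _) => [is' r] /= /eqP is0; rewrite is0 in e.
by have [y [k [_ h _]]] := run_eval e; exists y.
Qed.

Lemma halts_leq e x s t : s <= t ->
  (run o s ([:: e], [:: x])).1 == [::] -> (run o t ([:: e], [:: x])).1 == [::].
Proof.
move=> /subnK <-; rewrite run_add; case: (run o s _) => [is' r] /= /eqP ->.
by rewrite run_nil.
Qed.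

End MachineCorrect.

Lemma set0_xpred0 : [set x : nat | xpred0 x] = set0.
Proof. by apply/seteqP; split. Qed.

Lemma cmp_run X (eX : encodable X) (o : X * nat -> bool) (t : X -> nat) (st : X -> state) :
  computable o -> computable t -> computable st ->
  computable (fun x => run (fun z => o (x, z)) (t x) (st x)).
Proof.
move=> co ct cst.
have cm : computable (fun p : X * (nat * state) => mstep (fun z => o (p.1, z)) p.2.2).
  rewrite /mstep; cmp.
  apply: (cmp_comp (f := o)); cmp.
apply: cmp_ext (cmp_iteri ct cst cm) => x /=.
by elim: (t x) => //= n ->.
Qed.

Lemma cmp_run0 X (eX : encodable X) (t : X -> nat) (st : X -> state) :
  computable t -> computable st -> computable (fun x => run xpred0 (t x) (st x)).
Proof. by apply: (cmp_run (o := fun=> false)); exact: cmp_const. Qed.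

Lemma search_code X (eX : encodable X) (P : X * nat -> bool) : computable P ->
  exists2 c, oracle_free c & forall x,
    (forall n, eval set0 c (enc x) n <-> P (x, n) /\ forall m, m < n -> ~~ P (x, m)).
Proof.
move=> /cmp_negb [F [c oc ec] eF]; exists (Mu c) => // x n.
have {ec eF} ecP m : eval set0 c (pairn (enc x) m) (~~ P (x, m)).
  by rewrite [nat_of_bool _](eF (x, m)); exact: ec.
split=> [/eval_inv [h hk]|[Pn hn]].
  split=> [|m /hk [k hm]].
    by have := eval_fun h (ecP _); case: (P _).
  by have := eval_fun hm (ecP _); case: (P _).
apply: (@eval_Mu _ _ _ _ (fun=> 0)) => [|m /hn Pm].
  by have := ecP n; rewrite Pn.
by have := ecP m; rewrite Pm.
Qed.

Lemma search_halts X (eX : encodable X) (P : X * nat -> bool) : computable P ->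
  exists2 c, oracle_free c &
    forall x, (exists y, eval set0 c (enc x) y) <-> exists k, P (x, k).
Proof.
move=> cP; have [c oc ec] := search_code cP; exists c => // x; split.
  by move=> [n /ec [Pn _]]; exists n.
move=> ex; exists (ex_minn ex); apply/ec; case: ex_minnP => n Pn nmin.
by split=> // m; apply: contraL => /nmin; rewrite -leqNgt.
Qed.

Lemma search_partial_computable (P : nat * nat -> bool) (G : nat * nat -> nat)
    (phi : nat -> option nat) :
  computable P -> computable G ->
  (forall x y, phi x = Some y <-> exists2 n, P (x, n) & G (x, n) = y) ->
  partial_computable phi.
Proof.
move=> cP [G' [d od ed] eG] phiP; have [c oc ec] := search_code cP.
have [i oi ei] := tc_id.
exists (Comp d (Pair i c)) => /= [|x y]; first by rewrite od oi oc.
have hG n : eval set0 d (pairn x n) (G (x, n)).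
  by rewrite [G _](eG (x, n)); exact: ed.
split=> [/phiP [n0 Pn0 en0]|]; last first.
  move=> /eval_inv [z /eval_inv [u [n [/eval_fun /(_ (ei x)) -> /ec [Pn _] ->]]] h].
  by apply/phiP; exists n => //; apply: eval_fun (hG n) h.
have ex : exists n, P (x, n) by exists n0.
case: (ex_minnP ex) => n Pn nmin.
have cn : eval set0 c x n.
  by apply/ec; split=> // m; apply: contraL => /nmin; rewrite -leqNgt.
have -> : y = G (x, n).
  have /phiP e1 : exists2 n, P (x, n) & G (x, n) = y by exists n0.
  have /phiP : exists2 m, P (x, m) & G (x, m) = G (x, n) by exists n.
  by rewrite e1 => -[].
exact: eval_Comp (eval_Pair (ei x) cn) (hG n).
Qed.

Lemma eval_use B c x y : eval B c x y ->
  exists u, forall B' : set nat, (forall z, z < u -> (B z <-> B' z)) -> eval B' c x y.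
Proof.
elim=> {c x y}.
- by move=> x; exists 0 => *; constructor.
- by move=> x; exists 0 => *; constructor.
- by move=> x y; exists 0 => *; constructor.
- by move=> x y; exists 0 => *; constructor.
- by move=> x Bx; exists x.+1 => B' BB'; constructor; apply/BB'.
- by move=> x Bx; exists x.+1 => B' BB'; apply: eval_Oracle_notin => B'x; apply: Bx; apply/BB'.
- move=> f g x y z _ [u hu] _ [v hv]; exists (maxn u v) => B' BB'.
  by apply: eval_Pair; [apply: hu|apply: hv] => w wu; apply: BB'; rewrite leq_max wu ?orbT.
- move=> f g x y z _ [u hu] _ [v hv]; exists (maxn u v) => B' BB'.
  by apply: (@eval_Comp _ _ _ _ y); [apply: hu|apply: hv] => w wu; apply: BB'; rewrite leq_max wu ?orbT.
- by move=> f g x y _ [u hu]; exists u => B' BB'; apply: eval_Prec0; apply: hu.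
- move=> f g x n y z _ [u hu] _ [v hv]; exists (maxn u v) => B' BB'.
  by apply: (@eval_PrecS _ _ _ _ _ y); [apply: hu|apply: hv] => w wu; apply: BB'; rewrite leq_max wu ?orbT.
- move=> f x n k _ [u hu] _ IH.
  have [v hv] : {v : nat -> nat & forall m, m < n -> forall B' : set nat,
      (forall z, z < v m -> (B z <-> B' z)) -> eval B' f (pairn x m) (k m).+1}.
    apply: (@choice _ _ (fun m v => m < n -> forall B' : set nat,
      (forall z, z < v -> (B z <-> B' z)) -> eval B' f (pairn x m) (k m).+1)) => m.
    by case: (ltnP m n) => mn; [have [v] := IH _ mn; exists v|exists 0].
  exists (maxn u (\max_(m < n) v m)) => B' BB'; apply: (@eval_Mu _ _ _ _ k).
    by apply: hu => z zu; apply: BB'; rewrite leq_max zu.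
  move=> m mn; apply: hv => // z zv; apply: BB'.
  rewrite leq_max; apply/orP; right; apply: leq_trans zv _.
  exact: (leq_bigmax (F := fun i : 'I_n => v i) (Ordinal mn)).
Qed.

(** * The priority construction *)

(* A string [x :: tau] is a node of the tree with its ancestors, the root [0]
   coming last. A history lists, most recent first, the actions [(e, sigma)]:
   requirement [e] has routed the path through [sigma]. *)
Notation history := (seq (nat * seq nat)).

Implicit Types (H K : history) (e s t : nat) (sigma tau : seq nat).

Definition dflt : nat * seq nat := (0, [::]).

(* Any earlier action of a requirement up to [e] has been injured, or belongs to
   a requirement of higher priority whose string the latest one extends. *)
Definition latest e H : history :=
  drop_until (fun K => (head dflt K).1 <= e) H.

Definition strings H : seq (seq nat) := [seq h.2 | h <- H].

Definition nodes H : seq nat := [seq head 0 h.2 | h <- H].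

(* Extending the tree only by nodes above the code of [latest e H] keeps that
   code itself out of the tree as long as the action stays in force. *)
Definition admissible e sigma H : bool :=
  let K := latest e.+1 H in
  let p := (head dflt K).2 in
  [&& (head dflt K).1 != e.+1, p != sigma, suffix p sigma &
      has (fun h => h.2 == sigma) H ||
      [&& has (fun h => h.2 == behead sigma) H,
          ~~ has (fun h => head 0 h.2 == head 0 sigma) H &
          enc K < head 0 sigma]].

Definition halted e sigma t : bool :=
  (run xpred0 t ([:: e], [:: enc sigma])).1 == [::].

Definition next s H : history :=
  let e := pl s in
  let sigma := dec (pl (pr s)) in
  let t := pr (pr s) in
  if admissible e sigma H && halted e sigma t then (e.+1, sigma) :: H else H.

Definition hist s : history := iteri s next [:: (0, [:: 0])].

Lemma cmp_latest X (eX : encodable X) (e : X -> nat) (H : X -> history) :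
  computable e -> computable H -> computable (fun x => latest (e x) (H x)).
Proof.
move=> ce cH.
apply: (cmp_drop_until (p := fun z => (head dflt z.2).1 <= e z.1)) => //.
cmp; apply: (cmp_comp (f := e)); cmp.
Qed.

Lemma cmp_hist X (eX : encodable X) (s : X -> nat) :
  computable s -> computable (fun x => hist (s x)).
Proof.
move=> cs; rewrite /hist.
apply: (cmp_iteri (f := fun z : X * (nat * history) => next z.2.1 z.2.2)) => //.
  exact: cmp_const.
pose Y : Type := (X * (nat * history))%type.
have ce : computable (fun z : Y => pl z.2.1) by cmp.
have cK : computable (fun z : Y => latest (pl z.2.1).+1 z.2.2).
  by apply: cmp_latest; cmp.
have cS : computable (fun z : Y => dec (pl (pr z.2.1))) by cmp.
have cH : computable (fun z : Y => z.2.2) by cmp.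
rewrite /next /admissible; cmp.
- apply: (cmp_has (p := fun w => w.2.2 == dec (pl (pr w.1.2.1)))); cmp.
- apply: (cmp_has (p := fun w => w.2.2 == behead (dec (pl (pr w.1.2.1))))); cmp.
- apply: (cmp_has (p := fun w => head 0 w.2.2 == head 0 (dec (pl (pr w.1.2.1))))); cmp.
- by rewrite /halted; cmp; apply: cmp_run0; cmp.
Qed.

Lemma latest_cons e h H :
  latest e (h :: H) = if h.1 <= e then h :: H else latest e H.
Proof. by []. Qed.

Lemma latest_suffix e H : suffix (latest e H) H.
Proof.
elim: H => [|h H IH]; first by rewrite /latest /=.
rewrite latest_cons; case: ifP => _; first exact: suffix_refl.
exact: suffix_trans IH (suffix_cons _ _).
Qed.

Lemma latest_leq e H : (head dflt (latest e H)).1 <= e.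
Proof. by elim: H => [|h H IH] //; rewrite latest_cons; case: ifP. Qed.

Lemma latestS e H : (head dflt (latest e.+1 H)).1 != e.+1 ->
  latest e.+1 H = latest e H.
Proof.
elim: H => [|h H IH] //; rewrite !latest_cons.
case: (ltngtP h.1 e.+1) => [lt|gt|eq] /=.
- by rewrite -ltnS lt.
- by move=> /IH ->; rewrite leqNgt (ltn_trans (ltnSn _) gt).
- by rewrite eq eqxx.
Qed.

Lemma nextP s H : next s H = H \/
  [/\ next s H = ((pl s).+1, dec (pl (pr s))) :: H,
      admissible (pl s) (dec (pl (pr s))) H &
      halted (pl s) (dec (pl (pr s))) (pr (pr s))].
Proof. by rewrite /next; case: ifP => [/andP [? ?]|_]; [right|left]. Qed.

Lemma histS s : hist s.+1 = next s (hist s).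
Proof. by []. Qed.

Lemma hist_suffix s t : s <= t -> suffix (hist s) (hist t).
Proof.
move=> /subnK <-; elim: (t - s) => [|d IH]; first exact: suffix_refl.
rewrite addSn histS; have [->//|[-> _ _]] := nextP (d + s) (hist (d + s)).
exact: suffix_trans IH (suffix_cons _ _).
Qed.

Lemma suffix_enc T (eT : encodable T) (r s : seq T) :
  enc s <= enc (r ++ s).
Proof.
elim: r => //= x r IH; apply: leq_trans IH _.
by rewrite [leqRHS]enc_cons leqW // leq_pairnr.
Qed.

Lemma has_eq_map (T : eqType) (f : nat * seq nat -> T) y H :
  has (fun h => f h == y) H = (y \in map f H).
Proof. by elim: H => //= h H ->; rewrite in_cons eq_sym. Qed.

Lemma admissibleP e sigma H : reflect
  [/\ (head dflt (latest e.+1 H)).1 != e.+1,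
      (head dflt (latest e H)).2 != sigma,
      suffix (head dflt (latest e H)).2 sigma &
      sigma \in strings H \/
      [/\ behead sigma \in strings H, head 0 sigma \notin nodes H &
          enc (latest e H) < head 0 sigma]]
  (admissible e sigma H).
Proof.
rewrite /admissible !has_eq_map; apply: (iffP and4P).
  move=> [n1 n2 n3 /orP n4]; rewrite (latestS n1) in n2 n3 n4; split=> //.
  by case: n4 => [n4|/and3P [? ? ?]]; [left|right].
move=> [n1 n2 n3 n4]; split; rewrite ?(latestS n1) //; first by rewrite -(latestS n1).
by apply/orP; case: n4 => [n4|[? ? ?]]; [left|right; apply/and3P].
Qed.

Inductive legal : history -> Prop :=
| legal_root : legal [:: (0, [:: 0])]
| legal_act e sigma t H : legal H -> admissible e sigma H -> halted e sigma t ->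
    legal ((e.+1, sigma) :: H).

Lemma legal_hist s : legal (hist s).
Proof.
elim: s => [|s IH]; first exact: legal_root.
rewrite histS; have [->//|[-> ad ht]] := nextP s (hist s).
exact: legal_act IH ad ht.
Qed.

Lemma latest_nonempty e H : legal H -> latest e H != [::].
Proof.
elim=> [|i sigma t K _ IH _ _]; first by [].
by rewrite latest_cons; case: ifP.
Qed.

Lemma head_latest e H : legal H -> head dflt (latest e H) \in H.
Proof.
move=> /(latest_nonempty e); have /suffixP [r er] := latest_suffix e H.
rewrite {3}er; case: (latest e H) => // h K _.
by rewrite mem_cat in_cons eqxx orbT.
Qed.

Lemma string_nonempty H sigma : legal H -> sigma \in strings H -> sigma != [::].
Proof.
move=> lH; elim: lH sigma => [|e sigma t K lK IH /admissibleP [_ _ sf _] _] tau.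
  by rewrite inE => /eqP ->.
rewrite inE /= => /orP [/eqP ->|/IH //]; apply: contraTneq sf => ->.
by rewrite suffixs0; apply: IH; apply: map_f; exact: head_latest.
Qed.

Lemma string_behead H x tau : legal H ->
  x :: tau \in strings H -> tau != [::] -> tau \in strings H.
Proof.
move=> lH; elim: lH x tau => [|e sigma t K lK IH /admissibleP [_ _ _ ad] _] x tau.
  by rewrite inE => /eqP [_ ->].
rewrite !inE /= => /orP [/eqP es|/IH hI]; last by move=> /hI ->; rewrite orbT.
subst sigma; case: ad => [/IH hI|[/= -> _ _]]; last by rewrite orbT.
by move=> /hI ->; rewrite orbT.
Qed.

Lemma string_suffix H sigma tau : legal H ->
  suffix tau sigma -> tau != [::] -> sigma \in strings H -> tau \in strings H.
Proof.
move=> lH /suffixP [r ->] tn0; elim: r => //= x r IH /string_behead h.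
by apply: IH; apply: h => //; case: r.
Qed.

Lemma string_nodes H sigma y : legal H ->
  sigma \in strings H -> y \in sigma -> y \in nodes H.
Proof.
move=> lH hs /splitPr e; case: e hs => r q hs.
have : y :: q \in strings H.
  by apply: string_suffix hs => //; exact: suffix_suffix.
by move=> /mapP [h hH eh]; apply/mapP; exists h; rewrite // -eh.
Qed.

Lemma nodes_string H x : legal H -> x \in nodes H -> exists tau, x :: tau \in strings H.
Proof.
move=> lH /mapP [h hH ->]; have hS : h.2 \in strings H by exact: map_f.
have := string_nonempty lH hS; case e: h.2 => [//|y tau] _.
by exists tau; rewrite -e.
Qed.

Lemma string_uniq H sigma : legal H -> sigma \in strings H -> uniq sigma.
Proof.
move=> lH; elim: lH sigma => [|e sigma t K lK IH /admissibleP [_ _ _ ad] _] tau.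
  by rewrite inE => /eqP ->.
rewrite inE /= => /orP [/eqP ->|/IH //]; case: ad => [/IH //|[hb hn _]].
case: sigma hb hn => [|x sigma] //= hb hn; rewrite IH // andbT.
by apply: contra hn => /string_nodes ->.
Qed.

Lemma string_inj H x tau tau' : legal H ->
  x :: tau \in strings H -> x :: tau' \in strings H -> tau = tau'.
Proof.
move=> lH; elim: lH x tau tau' => [|e sigma t K lK IH /admissibleP [_ _ _ ad] _] x tau tau'.
  by rewrite !inE => /eqP [_ ->] /eqP [_ ->].
case: ad => [hs|[hb hn _]].
  have mE : strings ((e.+1, sigma) :: K) =i strings K.
    by move=> r; rewrite inE; case: eqP => // ->.
  by rewrite !mE; exact: IH.
have no r : x :: r \in strings K -> x :: r <> sigma.
  move=> /(string_nodes lK) hx er; move: hn; rewrite -er /= hx //.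
  exact: mem_head.
rewrite !inE /= => /orP [/eqP e1|h1] /orP [/eqP e2|h2].
- by move: e1; rewrite -e2 => -[].
- by move: (no _ h2); rewrite -e1 => /=; subst sigma; move: hn => /=;
    rewrite (string_nodes lK h2) ?mem_head.
- by subst sigma; move: hn => /=; rewrite (string_nodes lK h1) ?mem_head.
- exact: IH h1 h2.
Qed.

Lemma latest_latest e i H : e <= i -> latest e (latest i H) = latest e H.
Proof.
move=> ei; elim: H => [|h H IH] //; rewrite !latest_cons.
case: ifP => hi; first by rewrite latest_cons.
by rewrite IH ifN // -ltnNge (leq_ltn_trans ei) // ltnNge hi.
Qed.

Lemma enc_latest e i H : e <= i -> enc (latest e H) <= enc (latest i H).
Proof.
move=> /latest_latest <-; have /suffixP [r {2}->] := latest_suffix e (latest i H).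
exact: suffix_enc.
Qed.

Lemma latest_extends e i H : legal H -> e <= i ->
  suffix (head dflt (latest e H)).2 (head dflt (latest i H)).2.
Proof.
move=> lH; elim: lH i => [|j sigma t K lK IH /admissibleP [_ _ sf _] _] i ei.
  exact: suffix_refl.
rewrite !latest_cons /=; case: (ltnP j e) => je.
  by rewrite (leq_trans je ei) suffix_refl.
case: ifP => ji; last exact: IH.
exact: suffix_trans (IH _ je) sf.
Qed.

Lemma string_latest e H sigma : legal H -> sigma \in strings H ->
  sigma \in strings (latest e H) \/ suffix (head dflt (latest e H)).2 sigma.
Proof.
move=> lH; elim: lH sigma => [|j sigma t K lK IH /admissibleP [_ _ sf _] _] tau.
  by left.
rewrite latest_cons /=; case: (ltnP j e) => je; first by left.
rewrite inE /= => /orP [/eqP ->|/IH //]; right.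
exact: suffix_trans (latest_extends lK je) sf.
Qed.

Lemma node_lt_enc H x : x \in nodes H -> x < enc H.
Proof.
elim: H => // h H IH; rewrite inE enc_cons ltnS => /orP [/eqP ->|/IH hx].
  apply: leq_trans _ (leq_pairnl _ _); apply: leq_trans _ (leq_pairnr _ _).
  by case: h.2 => // y s; rewrite [leqRHS]enc_cons leqW // leq_pairnl.
exact: leq_trans (ltnW hx) (leq_pairnr _ _).
Qed.

Lemma enc_latest_notin e H : legal H -> enc (latest e H) \notin nodes H.
Proof.
move=> lH; elim: lH => [|j sigma t K lK IH /admissibleP [_ _ _ ad] _].
  by apply/negP => h; have := node_lt_enc h; rewrite ltnn.
rewrite latest_cons; case: ifPn => [_|].
  by apply/negP => h; have := node_lt_enc h; rewrite ltnn.
rewrite -leqNgt /= => je; rewrite inE negb_or IH andbT; case: ad => [hs|[_ _ lt]].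
  apply: contraNneq IH => /= ->; apply/mapP.
  by have /mapP [h hK ->] := hs; exists h.
by apply: contraTneq lt => /= <-; rewrite -leqNgt enc_latest.
Qed.

Lemma legal_latest e H : legal H -> legal (latest e H).
Proof.
elim=> [|j sigma t K lK IH ad ht]; first exact: legal_root.
by rewrite latest_cons; case: ifP => // _; exact: legal_act ht.
Qed.

Lemma action_unsatisfied s : hist s.+1 <> hist s ->
  (head dflt (latest (pl s).+1 (hist s))).1 != (pl s).+1.
Proof. by rewrite histS; have [->//|[_ /admissibleP [] //]] := nextP s (hist s). Qed.

Lemma latest_action e s : hist s.+1 <> hist s ->
  latest e (hist s.+1) = if (pl s).+1 <= e then hist s.+1 else latest e (hist s).
Proof. by rewrite histS; have [->//|[-> _ _]] := nextP s (hist s). Qed.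

Lemma head_action s : hist s.+1 <> hist s -> (head dflt (hist s.+1)).1 = (pl s).+1.
Proof. by rewrite histS; have [->//|[-> _ _]] := nextP s (hist s). Qed.

Lemma satisfied_persists e s0 s1 :
  (forall s, s0 <= s -> hist s.+1 <> hist s -> e <= pl s) ->
  s0 <= s1 -> hist s1.+1 <> hist s1 -> pl s1 = e ->
  forall s, s1 < s -> (head dflt (latest e.+1 (hist s))).1 = e.+1.
Proof.
move=> hs0 s01 ne1 e1; elim=> // s IH; rewrite ltnS leq_eqVlt => /orP [/eqP <-|ss].
  by rewrite latest_action // e1 leqnn head_action // e1.
have [->|ne] := pselect (hist s.+1 = hist s); first exact: IH.
have := hs0 _ (leq_trans s01 (ltnW ss)) ne.
rewrite leq_eqVlt => /orP [/eqP es|lt].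
  by have := action_unsatisfied ne; rewrite -es IH ?eqxx.
by rewrite latest_action // ltnNge lt /= IH.
Qed.

(* Finite injury: once the requirements up to [e] have come to rest, requirement
   [e.+1] acts at most once. *)
Lemma finite_injury e :
  exists s0, forall s, s0 <= s -> hist s.+1 <> hist s -> e <= pl s.
Proof.
elim: e => [|e [s0 hs0]]; first by exists 0.
have [[s1 [s01 ne1 e1]]|no] :=
  pselect (exists s, [/\ s0 <= s, hist s.+1 <> hist s & pl s = e]); last first.
  exists s0 => s ss ne; rewrite ltn_neqAle hs0 // andbT eq_sym.
  by apply/eqP => es; apply: no; exists s.
exists s1.+1 => s ss ne; rewrite ltn_neqAle hs0 ?andbT //; last first.
  exact: leq_trans s01 (ltnW ss).
apply/eqP => es; have := action_unsatisfied ne.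
by rewrite -es (satisfied_persists hs0 s01) ?eqxx.
Qed.

Lemma latest_stable e :
  exists s0, (forall s, s0 <= s -> latest e (hist s) = latest e (hist s0)) /\
    forall s, s0 <= s -> hist s.+1 <> hist s -> e <= pl s.
Proof.
have [s0 hs0] := finite_injury e; exists s0; split=> // s /subnK <-.
elim: (s - s0) => // d <-; rewrite addSn.
have [->//|ne] := pselect (hist (d + s0).+1 = hist (d + s0)).
by rewrite latest_action // ltnNge hs0 // leq_addl.
Qed.

Definition tree sigma : Prop := exists s, sigma \in strings (hist s).

Lemma strings_hist_leq s t sigma : s <= t ->
  sigma \in strings (hist s) -> sigma \in strings (hist t).
Proof.
move=> /hist_suffix /suffixP [r ->].
by rewrite /strings map_cat mem_cat => ->; rewrite orbT.
Qed.

Lemma tree_suffix sigma tau : suffix tau sigma -> tau != [::] -> tree sigma -> tree tau.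
Proof.
move=> sf t0 [s hs]; exists s; exact: string_suffix (legal_hist s) sf t0 hs.
Qed.

Lemma tree_inj x tau tau' : tree (x :: tau) -> tree (x :: tau') -> tau = tau'.
Proof.
move=> [s hs] [t ht]; apply: (string_inj (legal_hist (maxn s t))).
  exact: strings_hist_leq (leq_maxl _ _) hs.
exact: strings_hist_leq (leq_maxr _ _) ht.
Qed.

Lemma tree_uniq sigma : tree sigma -> uniq sigma.
Proof. by move=> [s]; exact: string_uniq (legal_hist s). Qed.

Definition rest e : nat := projT1 (cid (latest_stable e)).

Definition final e : history := latest e (hist (rest e)).

Definition barrier e : nat := enc (final e).

Definition pathstr e : seq nat := (head dflt (final e)).2.

Lemma latest_final e s : rest e <= s -> latest e (hist s) = final e.
Proof. by have [h _] := projT2 (cid (latest_stable e)); exact: h. Qed.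

Lemma rest_action e s : rest e <= s -> hist s.+1 <> hist s -> e <= pl s.
Proof. by have [_ h] := projT2 (cid (latest_stable e)); exact: h. Qed.

Lemma pathstr_suffix e i : e <= i -> suffix (pathstr e) (pathstr i).
Proof.
move=> ei; have := latest_extends (legal_hist (maxn (rest e) (rest i))) ei.
by rewrite !latest_final ?leq_maxl ?leq_maxr.
Qed.

Lemma pathstr_string e : pathstr e \in strings (hist (rest e)).
Proof. by apply: map_f; apply: head_latest; exact: legal_hist. Qed.

Lemma pathstr_nonempty e : pathstr e != [::].
Proof. exact: string_nonempty (legal_hist _) (pathstr_string e). Qed.

Definition fresh x : Prop := forall tau, ~ tree (x :: tau).

Lemma fresh_final e : fresh (barrier e).
Proof.
move=> tau [s hs]; set t := maxn (rest e) s.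
have := enc_latest_notin e (legal_hist t); rewrite latest_final ?leq_maxl // => /negP.
apply; apply: string_nodes (legal_hist t) (strings_hist_leq (leq_maxr _ _) hs) _.
exact: mem_head.
Qed.

(* The strings open to a requirement at rest with barrier [m] and path [p]. *)
Definition eligible m p sigma : Prop :=
  [/\ p <> sigma, suffix p sigma &
      tree sigma \/ [/\ tree (behead sigma), fresh (head 0 sigma) & m < head 0 sigma]].

Lemma tree_string sigma : tree sigma ->
  exists s0, forall s, s0 <= s -> sigma \in strings (hist s).
Proof. by move=> [s0 h]; exists s0 => s ss; exact: strings_hist_leq h. Qed.

Lemma requirement_met e :
  (exists t, halted e (pathstr e.+1) t) /\ pathstr e <> pathstr e.+1 \/
  forall sigma t, halted e sigma t ->
    ~ eligible (barrier e) (pathstr e) sigma.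
Proof.
have [id_e|ne] := eqVneq (head dflt (final e.+1)).1 e.+1.
  left; set s := maxn (rest e) (rest e.+1).
  have l1 : latest e.+1 (hist s) = final e.+1 by rewrite latest_final ?leq_maxr.
  have l0 : latest e (hist s) = final e by rewrite latest_final ?leq_maxl.
  have := legal_latest e.+1 (legal_hist s).
  have := latest_latest (hist s) (leqnSn e); rewrite l0 l1 /pathstr.
  move: id_e => /[swap] + /[swap] lf; case: lf => // i sigma t K lK ad ht.
  rewrite latest_cons /= => lK0 [ei]; subst i; move: lK0; rewrite ltnn => lK0.
  split; first by exists t.
  by have /admissibleP [_ /eqP] := ad; rewrite lK0.
right=> sigma t ht [np sf tr].
have fE : final e.+1 = final e.
  set s := maxn (rest e) (rest e.+1).
  rewrite -(@latest_final e.+1 s) ?leq_maxr // -(@latest_final e s) ?leq_maxl //.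
  by apply: latestS; rewrite latest_final ?leq_maxr.
have [s0 hs0] : exists s0, forall s, s0 <= s -> sigma \in strings (hist s) \/
    [/\ behead sigma \in strings (hist s), head 0 sigma \notin nodes (hist s) &
        barrier e < head 0 sigma].
  case: tr => [/tree_string [s0 h0]|[/tree_string [s0 h0] fr lt]]; exists s0 => s ss.
    by left; exact: h0.
  right; split=> //; first exact: h0.
  by apply/negP => /(nodes_string (legal_hist s)) [tau ht']; apply: (fr tau); exists s.
pose r := maxn t (maxn s0 (maxn (rest e) (rest e.+1))).
pose (s := pairn e (pairn (enc sigma) r)).
have rs : r <= s := leq_trans (leq_pairnr _ _) (leq_pairnr _ _).
have le1 : rest e <= s by rewrite (leq_trans _ rs) // /r !leq_max leqnn !orbT.
have le2 : rest e.+1 <= s by rewrite (leq_trans _ rs) // /r !leq_max leqnn !orbT.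
have le3 : s0 <= s by rewrite (leq_trans _ rs) // /r !leq_max leqnn !orbT.
have ad : admissible e sigma (hist s).
  apply/admissibleP; rewrite !latest_final //; split=> //; first exact/eqP.
  exact: hs0.
have hr : halted e sigma r by apply: halts_leq ht; rewrite leq_max leqnn.
have := @latest_final e.+1 s.+1 (leqW le2).
rewrite histS /next /s !(pl_pairn, pr_pairn) encK -/s ad hr /= latest_cons leqnn.
by move=> ef; move: ne; rewrite -ef eqxx.
Qed.

Lemma gn_unbounded n : exists2 c, n <= gn c & forall x, exists y, eval set0 c x y.
Proof.
elim: n => [|n [c nc hc]]; first by exists Zero => // x; exists 0; constructor.
exists (Comp Zero c) => [|x].
  apply: leq_ltn_trans nc _ => /=.
  have := leq_add_pairn 6 (pairn (pairn 0 0) (gn c)).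
  have := leq_pairnr (pairn 0 0) (gn c); lia.
by have [y hy] := hc x; exists 0; apply: eval_Comp hy _; constructor.
Qed.

Lemma haltedP c sigma :
  (exists y, eval set0 c (enc sigma) y) <-> exists t, halted (gn c) sigma t.
Proof. by rewrite -set0_xpred0; exact: haltsP. Qed.

Lemma enc_final_leq e i : e <= i -> final e <> final i -> barrier e < barrier i.
Proof.
move=> ei ne; rewrite ltn_neqAle /barrier enc_eq; apply/andP; split; first exact/eqP.
have := enc_latest (hist (maxn (rest e) (rest i))) ei.
by rewrite !latest_final ?leq_maxl ?leq_maxr.
Qed.

Lemma final_const_hist e : (forall i, e <= i -> final i = final e) ->
  forall s, rest e <= s -> hist s = hist (rest e).
Proof.
move=> hf; have [noact|act] := pselect (forall s, rest e <= s -> hist s.+1 = hist s).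
  move=> s /subnK <-; elim: (s - rest e) => // d <-.
  by rewrite addSn noact // leq_addl.
exfalso; pose A j := exists s, [/\ rest e <= s, hist s.+1 <> hist s & pl s = j].
have ex : exists j, `[< A j >].
  move/existsNP: act => [s /not_implyP [es ne]].
  by exists (pl s); apply/asboolP; exists s.
case: (ex_minnP ex) => j /asboolP [s1 [es1 ne1 ej]] jmin.
have hmin s : rest e <= s -> hist s.+1 <> hist s -> j <= pl s.
  by move=> es ne; apply: jmin; apply/asboolP; exists s.
have e_j : e <= j by rewrite -ej; exact: rest_action ne1.
have := satisfied_persists hmin es1 ne1 ej (leq_maxr (rest j.+1) s1.+1).
rewrite latest_final ?leq_maxl // hf ?(leq_trans e_j) // => ideq.
have := latest_leq e (hist (rest e)); rewrite -/(final e) ideq ltnNge.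
by rewrite e_j.
Qed.

Lemma fresh_unbounded m : exists2 x, fresh x & m < x.
Proof.
have [[e he]|hn] := pselect (exists e, forall i, e <= i -> final i = final e).
  exists (enc (hist (rest e)) + m).+1; last by rewrite ltnS leq_addl.
  move=> tau /tree_string [s0 /(_ (maxn s0 (rest e)) (leq_maxl _ _)) hs].
  rewrite (final_const_hist he) ?leq_maxr // in hs.
  have := node_lt_enc (string_nodes (legal_hist _) hs (mem_head _ _)).
  by rewrite ltnNge leqW // leq_addr.
suff [e he] : exists e, m < barrier e by exists (barrier e) => //; exact: fresh_final.
have up e : exists e', barrier e < barrier e'.
  have /existsNP [i /not_implyP [ei ne]] : ~ forall i, e <= i -> final i = final e.
    by move=> h; apply: hn; exists e.
  by exists i; apply: enc_final_leq => // /esym.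
elim: m => [|m [e he]]; last by have [i hi] := up e; exists i; exact: leq_ltn_trans he hi.
by have [i hi] := up 0; exists i; exact: leq_ltn_trans (leq0n _) hi.
Qed.

Lemma pathstr_unbounded n : exists e, n < size (pathstr e).
Proof.
elim: n => [|n [e he]].
  by exists 0; rewrite lt0n size_eq0; exact: pathstr_nonempty.
have [c ec hc] := gn_unbounded e.
have [[_ ne]|no] := requirement_met (gn c).
  exists (gn c).+1; have /suffixP [[|x r] er] := pathstr_suffix (leqnSn (gn c)).
    by case: ne; rewrite er.
  rewrite er size_cat /= addSn ltnS; apply: leq_trans (leq_addl _ _).
  exact: leq_trans he (size_suffix (pathstr_suffix ec)).
have [x fx lx] := fresh_unbounded (barrier (gn c)).
have [t ht] : exists t, halted (gn c) (x :: pathstr (gn c)) t.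
  by apply/haltedP; exact: hc.
case: (no _ _ ht); split.
- by move=> /(congr1 size) /= /eqP; rewrite -[X in X == _]addn0 -addn1 eqn_add2l.
- exact: suffix_cons.
- by right; split=> //=; exists (rest (gn c)); exact: pathstr_string.
Qed.

(** * The generic path *)

Definition path_elt n : nat :=
  nth 0 (rev (pathstr (projT1 (cid (pathstr_unbounded n))))) n.

Definition initial n : seq nat := rev (mkseq path_elt n).

Lemma initialS n : initial n.+1 = path_elt n :: initial n.
Proof. by rewrite /initial mkseqS rev_rcons. Qed.

Lemma size_initial n : size (initial n) = n.
Proof. by rewrite size_rev size_mkseq. Qed.

Lemma path_eltE e n : n < size (pathstr e) -> path_elt n = nth 0 (rev (pathstr e)) n.
Proof.
rewrite /path_elt; case: cid => i /= hi he.
have [ei|/ltnW ie] := leqP e i.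
  have /suffixP [r ->] := pathstr_suffix ei.
  by rewrite rev_cat nth_cat size_rev he.
have /suffixP [r ->] := pathstr_suffix ie.
by rewrite rev_cat nth_cat size_rev hi.
Qed.

Lemma pathstrE e : pathstr e = initial (size (pathstr e)).
Proof.
rewrite -[LHS]revK; congr rev; apply: (@eq_from_nth _ 0).
  by rewrite size_rev size_mkseq.
by move=> n; rewrite size_rev => he; rewrite nth_mkseq // (path_eltE he).
Qed.

Lemma initial_suffix m n : m <= n -> suffix (initial m) (initial n).
Proof.
move=> /subnK <-; elim: (n - m) => [|d IH]; first exact: suffix_refl.
by rewrite addSn initialS; exact: suffix_trans IH (suffix_cons _ _).
Qed.

Lemma tree_initial n : tree (initial n.+1).
Proof.
have [e he] := pathstr_unbounded n.
apply: (tree_suffix (sigma := pathstr e)); last by exists (rest e); exact: pathstr_string.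
  by rewrite pathstrE; exact: initial_suffix.
by rewrite initialS.
Qed.

Lemma mem_initial x n : reflect (exists2 i, i < n & x = path_elt i) (x \in initial n).
Proof.
rewrite mem_rev; apply: (iffP mapP) => -[i]; rewrite ?mem_iota => hi ->.
  by exists i.
by exists i; rewrite ?mem_iota.
Qed.

Lemma path_elt_inj : injective path_elt.
Proof.
suff lt i j : i < j -> path_elt i <> path_elt j.
  by move=> i j eij; case: (ltngtP i j) => // /lt; rewrite eij.
move=> ij eij; have := tree_uniq (tree_initial j).
rewrite initialS /= -eij => /andP [/negP + _]; apply.
by apply/mem_initial; exists i.
Qed.

Lemma tree_cofinite_above n : exists u, forall x tau,
  u <= x -> tree (x :: tau) -> suffix (initial n.+1) (x :: tau).
Proof.
have [e he] := pathstr_unbounded n; exists (barrier e) => x tau ux.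
move=> /tree_string [s0 /(_ (maxn s0 (rest e)) (leq_maxl _ _)) hs].
have [] := string_latest e (legal_hist _) hs; rewrite latest_final ?leq_maxr //.
  move=> hx; have : x \in nodes (final e).
    by have /mapP [h hK eh] := hx; apply/mapP; exists h; rewrite -?eh.
  by move=> h; have := node_lt_enc h; rewrite ltnNge ux.
rewrite -/(pathstr e) pathstrE; apply: suffix_trans; exact: initial_suffix.
Qed.

Lemma generic (P : seq nat * nat -> bool) : computable P -> exists n m,
  (exists k, P (initial n.+1, k)) \/
  forall sigma k, P (sigma, k) -> ~ eligible m (initial n.+1) sigma.
Proof.
move=> /search_halts [c oc hc].
have iE e : exists n, pathstr e = initial n.+1.
  exists (size (pathstr e)).-1; rewrite prednK ?lt0n ?size_eq0 ?pathstr_nonempty //.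
  exact: pathstrE.
have [[/haltedP/hc hk _]|no] := requirement_met (gn c).
  by have [n en] := iE (gn c).+1; exists n, 0; left; rewrite -en.
have [n en] := iE (gn c); exists n, (barrier (gn c)); right.
move=> sigma k Pk; rewrite -en.
have [t ht] : exists t, halted (gn c) sigma t.
  by apply/haltedP/hc; exists k.
exact: no ht.
Qed.

(** * Properties of the generic path *)

Definition path_set : set nat := range path_elt.

Lemma seq_bounded (s : seq nat) : exists u, forall x, x \in s -> x < u.
Proof.
elim: s => [|y s [u hu]]; first by exists 0.
exists (maxn y.+1 u) => x; rewrite in_cons leq_max => /orP [/eqP ->|/hu ->].
  by rewrite leqnn.
by rewrite orbT.
Qed.

Lemma infinite_set_natP (S : set nat) :
  infinite_set S <-> forall n, exists2 x, S x & n <= x.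
Proof.
split=> [iS n|hS /finite_seqP [s Ss]].
  apply: contrapT => no; apply: iS; apply: (@sub_finite_set _ _ `I_n) => //.
  move=> x Sx /=; rewrite ltnNge; apply/negP => nx; apply: no; by exists x.
have [u hu] := seq_bounded s; have [x] := hS u; rewrite Ss => /hu.
by rewrite ltnNge => /negbTE ->.
Qed.

Lemma path_set_unbounded n : exists2 x, path_set x & n <= x.
Proof.
suff : infinite_set path_set by move=> /infinite_set_natP.
move=> /finite_seqP [s hs].
have : {subset mkseq path_elt (size s).+1 <= s}.
  move=> x /mapP [i _ ->].
  have : path_set (path_elt i) by exists i.
  by rewrite hs.
move=> /uniq_leq_size; rewrite size_mkseq ltnn mkseq_uniq; first by move/(_ isT).
exact: path_elt_inj.
Qed.

Lemma path_set_initial x n : x \in initial n -> path_set x.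
Proof. by move=> /mem_initial [i _ ->]; exists i. Qed.

Lemma path_set_below u : exists N, forall x, path_set x -> x < u -> x \in initial N.
Proof.
elim: u => [|u [N hN]]; first by exists 0.
have [[i _ ei]|nu] := pselect (path_set u).
  exists (maxn i.+1 N) => x Ax; rewrite ltnS leq_eqVlt => /orP [/eqP ->|xu].
    by apply/mem_initial; exists i => //; rewrite leq_max leqnn.
  have /mem_initial [j jN ->] := hN _ Ax xu.
  by apply/mem_initial; exists j => //; rewrite leq_max jN orbT.
exists N => x Ax; rewrite ltnS leq_eqVlt => /orP [/eqP xu|]; last exact: hN.
by case: nu; rewrite -xu.
Qed.

Lemma fresh_notin x : fresh x -> ~ path_set x.
Proof.
by move=> fx [i _ ei]; apply: (fx (initial i)); rewrite -ei -initialS; exact: tree_initial.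
Qed.

Lemma eligible_fresh m n k x : fresh x -> m < x -> n <= k ->
  eligible m (initial n.+1) (x :: initial k.+1).
Proof.
move=> fx mx nk; split.
- by move=> /(congr1 size); rewrite /= !size_initial; lia.
- by apply: suffix_trans (suffix_cons _ _); exact: initial_suffix.
- by right; split=> //; exact: tree_initial.
Qed.

Lemma cmp_strings_hist X (eX : encodable X) (sigma : X -> seq nat) (s : X -> nat) :
  computable sigma -> computable s ->
  computable (fun x => sigma x \in strings (hist (s x))).
Proof.
move=> cs cst.
have cp : computable (fun w : X * (nat * seq nat) => w.2.2 == sigma w.1).
  by cmp; apply: (cmp_comp cs); cmp.
apply: cmp_ext (cmp_has cp (cmp_hist cst)) => x.
by rewrite /strings -(has_eq_map snd).
Qed.

Definition regress x : option nat :=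
  if pselect (exists tau, tree (x :: tau)) is left h
  then Some (head x (projT1 (cid h))) else None.

Lemma regressE x tau : tree (x :: tau) -> regress x = Some (head x tau).
Proof.
move=> tx; rewrite /regress; case: pselect => [h|[]]; last by exists tau.
by case: (cid h) => tau' /= tx'; rewrite (tree_inj tx tx').
Qed.

Lemma regress_partial_computable : partial_computable regress.
Proof.
pose P (w : nat * nat) := w.1 :: dec (pl w.2) \in strings (hist (pr w.2)).
pose G (w : nat * nat) :=
  if dec (pl w.2) == [::] then w.1 else head 0 (dec (pl w.2)).
apply: (@search_partial_computable P G).
- by apply: cmp_strings_hist; cmp.
- by rewrite /G; cmp.
move=> x y; split=> [|[n Pn <-]]; last first.
  rewrite (@regressE _ (dec (pl n))); last by exists (pr n).
  by rewrite /G /=; case: (dec _).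
rewrite /regress; case: pselect => // h; case: cid => tau /= [s hs] [<-].
exists (pairn (enc tau) s); rewrite /P /G /= pl_pairn ?pr_pairn encK //.
by case: (tau).
Qed.

Lemma path_set_regressive : regressive path_set.
Proof.
split; first by apply/infinite_set_natP; exact: path_set_unbounded.
exists path_elt, regress; split=> //.
- exact: path_elt_inj.
- exact: regress_partial_computable.
split=> [|n]; first by apply: (@regressE _ (initial 0)); exact: (tree_initial 0).
have := tree_initial n.+1; rewrite initialS => /regressE ->.
by rewrite initialS.
Qed.

Lemma partial_computable_run psi : partial_computable psi -> exists e, forall x y,
  psi x = Some y <-> exists t, run xpred0 t ([:: e], [:: x]) = ([::], [:: y]).
Proof.
move=> [c _ hc]; exists (gn c) => x y; rewrite hc -set0_xpred0; exact: evalP.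
Qed.

Lemma ce_run W : ce W -> exists e, forall x,
  W x <-> exists t, (run xpred0 t ([:: e], [:: x])).1 == [::].
Proof.
move=> [psi [c _ hc] ->]; exists (gn c) => x; rewrite -haltsP set0_xpred0 /=.
by split=> -[y /hc hy]; exists y.
Qed.

Lemma path_set_co_immune : co_immune path_set.
Proof.
move=> [W [WA /infinite_set_natP iW /ce_run [e he]]].
pose P (w : seq nat * nat) := (run xpred0 w.2 ([:: e], [:: head 0 w.1])).1 == [::].
have [|n [m [[k]|no]]] := @generic P.
- by rewrite /P; cmp; apply: cmp_run0; cmp.
- rewrite /P initialS /= => hk; apply: (WA (path_elt n)); last by exists n.
  by apply/he; exists k.
have [u hu] := tree_cofinite_above n.
have [x Wx] := iW (maxn u (maxn m.+1 (path_elt n).+1)).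
rewrite !geq_max => /and3P [ux mx ax]; have /he [k hk] := Wx.
have [[tau tx]|nt] := pselect (exists tau, tree (x :: tau)).
  apply: (no (x :: tau) k hk); split; last by left.
    by rewrite initialS => -[ex _]; rewrite ex ltnn in ax.
  exact: hu.
apply: (no (x :: initial n.+1) k hk); apply: eligible_fresh => //.
by move=> tau tx; apply: nt; exists tau.
Qed.

Lemma path_set_not_ce : ~ ce path_set.
Proof.
move=> /ce_run [e he].
pose P (w : seq nat * nat) :=
  [&& pl w.2 != head 0 w.1,
      (run xpred0 (pr (pr w.2)) ([:: e], [:: pl w.2])).1 == [::] &
      pl w.2 :: behead w.1 \in strings (hist (pl (pr w.2)))].
have ct : computable (fun w : seq nat * nat =>
    pl w.2 :: behead w.1 \in strings (hist (pl (pr w.2)))).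
  by apply: cmp_strings_hist; cmp.
have [|n [m [[k]|no]]] := @generic P.
- by rewrite /P; cmp; apply: cmp_run0; cmp.
- rewrite /P initialS /= => /and3P [ne hk hs].
  have [j _ ej] : path_set (pl k) by apply/he; exists (pr (pr k)).
  have tj : tree (path_elt j :: initial n) by exists (pl (pr k)); rewrite ej.
  have /(congr1 size) : initial n = initial j.
    by apply: tree_inj tj _; rewrite -initialS; exact: tree_initial.
  by rewrite !size_initial => nj; rewrite -ej nj eqxx in ne.
have [x fx mx] := fresh_unbounded m.
have [t ht] : exists t, (run xpred0 t ([:: e], [:: path_elt n.+1])).1 == [::].
  by apply/he; exists n.+1.
have [s hs] := tree_initial n.+1.
apply: (no (x :: initial n.+1) (pairn (path_elt n.+1) (pairn s t))).
  rewrite /P /= !(pl_pairn, pr_pairn) -initialS; apply/and3P; split=> //.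
  by apply/eqP => ex; apply: (fresh_notin fx); exists n.+1.
exact: eligible_fresh.
Qed.

Lemma path_set_not_retraceable : ~ retraceable path_set.
Proof.
move=> [_ [b [psi [Ab b_lt /partial_computable_run [e he] [psi0 psiS]]]]].
have b_mono : {mono b : i j / i < j}.
  by apply: leqW_mono; apply: leq_mono; apply: homo_ltn => //; exact: ltn_trans.
pose P (w : seq nat * nat) :=
  [&& pl w.2 \in behead w.1, pl (pr w.2) < head 0 w.1, head 0 w.1 < pl w.2 &
      run xpred0 (pr (pr w.2)) ([:: e], [:: pl w.2]) == ([::], [:: pl (pr w.2)])].
have [|n [m [[k]|no]]] := @generic P.
- by rewrite /P; cmp; apply: cmp_run0; cmp.
- rewrite /P initialS /= => /and4P [/path_set_initial Ay zx xy /eqP hk].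
  have hz : psi (pl k) = Some (pl (pr k)) by apply/he; exists (pr (pr k)).
  have : path_set (path_elt n) by exists n.
  move: Ay; rewrite Ab => -[j _ ej] [l _ el]; move: zx xy hz; rewrite -ej -el.
  case: j {ej} => [|j].
    by rewrite psi0 => /[swap] /ltnW h1 /[swap] -[<-]; rewrite ltnNge h1.
  rewrite psiS => /[swap] h1 /[swap] -[<-]; rewrite b_mono => h2.
  by move: h1; rewrite b_mono ltnS leqNgt h2.
have [x fx] := fresh_unbounded (maxn m (b 0)); rewrite gtn_max => /andP [mx bx].
have nbx j : b j <> x.
  by move=> ej; apply: (fresh_notin fx); rewrite Ab; exists j.
have ex : exists j, x < b j.
  exists x.+1; have id_le j : j <= b j by elim: j => // j IH; exact: leq_ltn_trans (b_lt j).
  exact: id_le.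
case: (ex_minnP ex) => -[|j] xj jmin; first by move: xj; rewrite ltnNge (ltnW bx).
have bjx : b j < x.
  rewrite ltn_neqAle; apply/andP; split; first by apply/eqP; exact: nbx.
  by rewrite leqNgt; apply/negP => /jmin; rewrite ltnn.
have [i _ ei] : path_set (b j.+1) by rewrite Ab; exists j.+1.
have /he [t ht] := psiS j.
apply: (no (x :: initial (maxn i n).+1) (pairn (b j.+1) (pairn (b j) t))).
  rewrite /P /= !(pl_pairn, pr_pairn) bjx xj ht eqxx !andbT.
  by apply/mem_initial; exists i; rewrite ?ei // ltnS leq_maxl.
by apply: eligible_fresh => //; exact: leq_maxr.
Qed.

(* A condition [(F, u)] promises that the subset of the path under construction
   meets [[0, u)] in [F]. *)
Definition condition (p : seq nat * nat) : Prop :=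
  forall z, z \in p.1 -> path_set z /\ z < p.2.

Definition meets (p : seq nat * nat) (C : set nat) : Prop :=
  forall z, z < p.2 -> (C z <-> z \in p.1).

Definition refines (q p : seq nat * nat) : Prop :=
  [/\ condition q, p.2 <= q.2 & forall z, z < p.2 -> (z \in q.1) = (z \in p.1)].

Definition defeats (c : code) (p : seq nat * nat) : Prop :=
  forall C : set nat, C `<=` path_set -> meets p C ->
  ~ forall x, (path_set x -> eval C c x 1) /\ (~ path_set x -> eval C c x 0).

Lemma refines_trans p q r : refines q p -> refines r q -> refines r p.
Proof.
move=> [_ pq hq] [cr qr hr]; split=> //; first exact: leq_trans qr.
by move=> z zp; rewrite hr ?hq // (leq_trans zp).
Qed.

Lemma defeat c p : condition p -> exists2 q, refines q p & defeats c q.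
Proof.
case: p => F u cF.
pose o (w : (seq nat * nat) * nat) := (w.2 \in F) ||
  [&& u <= w.2, w.2 \in behead w.1.1 & w.2 \in dec (pl w.1.2)].
pose P (w : seq nat * nat) :=
  run (fun z => o (w, z)) (pr w.2) ([:: gn c], [:: head 0 w.1]) == ([::], [:: 0]).
have [|n [m [[k]|no]]] := @generic P.
- rewrite /P; cmp; apply: (cmp_run (o := o)); cmp.
  by rewrite /o; cmp.
- rewrite /P => /eqP hk.
  have /evalP : exists t, run (fun z => o (initial n.+1, k, z)) t
      ([:: gn c], [:: head 0 (initial n.+1)]) = ([::], [:: 0]) by exists (pr k).
  move=> /eval_use [u0 hu0].
  pose F' := F ++ [seq z <- initial n | (u <= z) && (z \in dec (pl k))].
  have [b hb] := seq_bounded F'.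
  have oE z : o (initial n.+1, k, z) = (z \in F').
    by rewrite /o /= initialS /= mem_cat mem_filter -andbA [(z \in dec _) && _]andbC.
  exists (F', maxn u (maxn u0 b)) => [|C CA mC comp].
    split=> [z /= hz||z /= zu]; last 2 first.
    - exact: leq_maxl.
    - by rewrite mem_cat mem_filter leqNgt zu /= orbF.
    split; last by rewrite !leq_max hb // !orbT.
    move: hz; rewrite mem_cat => /orP [/cF [] //|].
    by rewrite mem_filter => /andP [_ /path_set_initial].
  have [h1 _] := comp (path_elt n).
  have /eval_fun : eval C c (path_elt n) 1 by apply: h1; exists n.
  move=> /(_ 0) h10; suff /h10 : eval C c (path_elt n) 0 by [].
  move: hu0; rewrite initialS /= -initialS => hu0; apply: hu0 => z zu.
  by rewrite /= oE; apply: iff_sym; apply: mC; rewrite /= !leq_max zu orbT.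
exists (F, u); first by split.
move=> C CA mC comp; have [x fx mx] := fresh_unbounded m.
have [_ /(_ (fresh_notin fx)) /eval_use [u0 hu0]] := comp x.
have [N0 hN0] := path_set_below u0; set N := (maxn N0 n).+1.
have hN z : path_set z -> z < u0 -> z \in initial N.
  move=> Az zu; have /mem_initial [i iN ->] := hN0 z Az zu.
  by apply/mem_initial; exists i => //; rewrite ltnS leq_max (ltnW iN).
pose D := [seq z <- initial N | `[< C z >]].
have /evalP [t ht] : eval [set z | o (x :: initial N, pairn (enc D) 0, z)] c x 0.
  apply: hu0 => z zu; rewrite /= /o /= pl_pairn encK mem_filter; split.
    move=> Cz; case: (ltnP z u) => zlt /=; first by rewrite (mC z zlt).1.
    have zN : z \in initial N by apply: hN => //; exact: CA.
    by apply/orP; right; rewrite zN andbT; apply/asboolP.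
  move=> /orP [zF|/and3P [_ _ /andP [/asboolP //]]].
  by have [_ zlt] := cF z zF; apply/(mC z zlt).
apply: (no (x :: initial N) (pairn (enc D) t)); last first.
  by apply: eligible_fresh => //; exact: leq_maxr.
rewrite /P /= pr_pairn -ht; apply/eqP; congr run.
by apply/funext => z; rewrite /o /= !pl_pairn.
Qed.

Lemma refines_grow p : condition p ->
  exists2 q, refines q p & exists2 z, z \in q.1 & p.2 <= z.
Proof.
case: p => F u cF; have [z Az uz] := path_set_unbounded u.
exists (z :: F, z.+1); last by exists z => //; exact: mem_head.
split=> /= [y|| y yu]; last 2 first.
- exact: leqW.
- by rewrite in_cons ltn_eqF // (leq_trans yu).
rewrite in_cons => /orP [/eqP ->|/cF [Ay yu]]; first by [].
by split=> //; rewrite ltnS ltnW // (leq_trans yu).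
Qed.

Lemma path_set_not_introreducible : ~ introreducible path_set.
Proof.
move=> [_ intro].
have [f hf] : {f : nat * (seq nat * nat) -> seq nat * nat & forall w,
    condition w.2 -> [/\ refines (f w) w.2,
      exists2 z, z \in (f w).1 & w.2.2 <= z &
      forall c, gn c = w.1 -> defeats c (f w)]}.
  apply: (@choice _ _ (fun w q => condition w.2 -> [/\ refines q w.2,
      exists2 z, z \in q.1 & w.2.2 <= z &
      forall c, gn c = w.1 -> defeats c q])) => -[i p] /=.
  have [cp|ncp] := pselect (condition p); last by exists p.
  have [q rq gq] := refines_grow cp.
  have cq : condition q by case: rq.
  have grow r : refines r q -> exists2 z, z \in r.1 & p.2 <= z.
    move=> [_ _ hr]; have [z zq pz] := gq; exists z => //; rewrite hr //.
    by have [] := cq z zq.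
  have [[c ec]|nc] := pselect (exists c, gn c = i); last first.
    exists q => _; split=> // c ec; by case: nc; exists c.
  have [r rr dr] := defeat c cq; exists r => _; split.
  - exact: refines_trans rr.
  - exact: grow.
  - by move=> d; rewrite -ec => /gn_inj ->.
pose S := fix S i := if i is j.+1 then f (j, S j) else ([::], 0).
have cS i : condition (S i).
  elim: i => [|i IH] //; by have [[]] := hf (i, S i) IH.
have rS i j : i <= j -> refines (S j) (S i).
  move=> /subnK <-; elim: (j - i) => [|d IH]; first by split.
  by apply: refines_trans IH _; have [] := hf (d + i, S (d + i)) (cS _).
pose C : set nat := [set z | exists i, z \in (S i).1].
have mC i : meets (S i) C.
  move=> z zi; split=> [[j zj]|zi']; last by exists i.
  have [ij|/ltnW ji] := leqP i j; first by have [_ _ <-] := rS _ _ ij.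
  by have [_ _ ->] := rS _ _ ji => //; have [] := cS _ _ zj.
have CA : C `<=` path_set by move=> z [i /cS []].
have S_ge i : i <= (S i).2.
  elim: i => // i IH; have [_ [z zS iz] _] := hf (i, S i) (cS i).
  have [_ zlt] := cS i.+1 z zS; exact: leq_ltn_trans (leq_trans IH iz) zlt.
have iC : infinite_set C.
  apply/infinite_set_natP => n; have [_ [z zS nz] _] := hf (n, S n) (cS n).
  by exists z; [exists n.+1|exact: leq_trans (S_ge n) nz].
have [c hc] := intro C CA iC.
have [_ _ /(_ c erefl)] := hf (gn c, S (gn c)) (cS _); apply; last exact: hc.
  exact: CA.
exact: (mC (gn c).+1).
Qed.

Theorem theorem5p18 :
  exists A : set nat,
    [/\ co_immune A, regressive A, ~ introreducible A, ~ ce A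
      & ~ retraceable A].
Proof.
exists path_set; split.
- exact: path_set_co_immune.
- exact: path_set_regressive.
- exact: path_set_not_introreducible.
- exact: path_set_not_ce.
- exact: path_set_not_retraceable.
Qed.
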